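(* Let $S$ be a closed densely defined symmetric operator with equal defect numbers in a Hilbert space $\mathfrak{H}$ which commutes with a non-trivial fundamental symmetry $J$, let $\{C_\alpha\}_{\alpha\in D}$ be the set of all $C$-symmetries of $S$, and let $\Upsilon$ be the set of $J$-self-adjoint extensions of $S$ which commute with every $C_\alpha$, $\alpha\in D$. Then: (i) If $A\in\Upsilon$, then for every $\alpha\in D$ the operator $A$ is a self-adjoint extension of $S$ with respect to the inner product $(\cdot,\cdot)_\alpha=(JC_\alpha\cdot,\cdot)$. (ii) If $r\in\mathbb{R}$ is a point of regular type of $S$, then the operator $A_r=S^*\upharpoonright\mathcal{D}(A_r)$, $\mathcal{D}(A_r)=\mathcal{D}(S)\dot{+}\ker(S^*-rI)$, belongs to $\Upsilon$. (iii) If $A\in\Upsilon$, then among all self-adjoint extensions $A'\supset S$ transversal to $A$ there exists at least one belonging to $\Upsilon$. (iv) If $S$ is nonnegative, then its Friedrichs extension and its Krein-von Neumann extension belong to $\Upsilon$.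
   Context: $\mathfrak{H}$ is a Hilbert space with inner product $(\cdot,\cdot)$. A fundamental symmetry is a bounded operator $J$ with $J=J^*$, $J^2=I$; it is non-trivial if $J\neq\pm I$. For a bounded operator $C$ and an operator $A$, ''$A$ commutes with $C$'', written $[A,C]=0$, means $AC=CA$ (including equality of domains). The operator $S$ satisfies $[S,J]=0$; $S^*$ is its adjoint with respect to $(\cdot,\cdot)$. $\{C_\alpha\}_{\alpha\in D}$ denotes the set (indexed by a set $D$) of all bounded operators $C$ in $\mathfrak{H}$ with $C^2=I$, $JC>0$ (i.e. $JC$ is self-adjoint and $(JCx,x)>0$ for $x\ne0$) and $SC=CS$. Each $(\cdot,\cdot)_\alpha=(JC_\alpha\cdot,\cdot)$ is an inner product on $\mathfrak{H}$ equivalent to $(\cdot,\cdot)$; for $C_\alpha=J$ it is the original one. ''Self-adjoint'' without further specification refers to $(\cdot,\cdot)$. An operator $A$ is $J$-self-adjoint if it is densely defined and $A^*J=JA$. $\Sigma_J$ is the set of $J$-self-adjoint extensions $A\supset S$, and $\Upsilon=\{A\in\Sigma_J : [A,C_\alpha]=0\ \ \forall\alpha\in D\}$. A real number $r$ is a point of regular type of $S$ if there is $k>0$ with $\|(S-rI)x\|\ge k\|x\|$ for all $x\in\mathcal{D}(S)$. Two self-adjoint extensions $A,A'$ of $S$ are transversal if $\mathcal{D}(A)\cap\mathcal{D}(A')=\mathcal{D}(S)$ and $\mathcal{D}(A)+\mathcal{D}(A')=\mathcal{D}(S^* )$. *)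

(* Defs.v *)
From HB Require Import structures.
From mathcomp Require Import all_boot all_order all_algebra.
From mathcomp Require Import complex.
From mathcomp Require Import all_classical all_reals all_analysis.
Import Order.TTheory GRing.Theory Num.Theory.
Import numFieldNormedType.Exports.

Set Implicit Arguments.
Unset Strict Implicit.
Unset Printing Implicit Defensive.

Local Open Scope classical_set_scope.
Local Open Scope ring_scope.
Local Open Scope complex_scope.

(* A complex Hilbert space is a complete normed space over R[i] whose norm
   comes from an inner product (linear in the first argument). *)
Definition is_hilbert (R : realType) (H : completeNormedModType R[i])
    (ip : {dot H for (@Num.conj R[i])}) : Prop :=
  forall x : H, ip x x = `|x| ^+ 2.

Section Operators.
Variables (R : realType) (H : completeNormedModType R[i]).

(* Unbounded operators are identified with their graphs in H * H, so that
   equality of operators (domains included) is equality of sets and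
   "B extends A" is inclusion of A in B. General sets T are linear relations;
   the adjoint and the inverse are defined at that level. *)
Implicit Types (T A B S : set (H * H)) (ip : H -> H -> R[i]).
Implicit Types (C J : {linear H -> H}).

Definition is_operator T : Prop :=
  [/\ T (0, 0),
      forall (a : R[i]) p q, T p -> T q -> T (a *: p.1 + q.1, a *: p.2 + q.2)
    & forall x y z, T (x, y) -> T (x, z) -> y = z].

Definition dom T : set H := [set x | exists y, T (x, y)].

Definition inverse T : set (H * H) := [set p | T (p.2, p.1)].

(* ker (T - c I) *)
Definition ker_sub T (c : R[i]) : set H := [set x | T (x, c *: x)].

(* The product T C, with C applied first. *)
Definition comp_right T C : set (H * H) := [set p | T (C p.1, p.2)].

(* The product C T, with T applied first. *)
Definition comp_left C T : set (H * H) :=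
  [set p | exists2 y, T (p.1, y) & p.2 = C y].

Definition commute_with T C : Prop := comp_right T C = comp_left C T.

Definition bounded_op C : Prop :=
  exists M : R[i], forall x, `|C x| <= M * `|x|.

Definition adjoint ip T : set (H * H) :=
  [set p | forall q, T q -> ip q.2 p.1 = ip q.1 p.2].

Definition symmetric_op ip T : Prop :=
  forall p q, T p -> T q -> ip p.2 q.1 = ip p.1 q.2.

(* Density refers to the norm of H; it is the same for every inner product
   ip equivalent to the original one. *)
Definition selfadjoint ip A : Prop :=
  [/\ is_operator A, dense (dom A) & adjoint ip A = A].

Definition selfadjoint_extension ip S A : Prop :=
  selfadjoint ip A /\ S `<=` A.

(* The order of R[i] is such that 0 <= z entails that z is real. *)
Definition nonnegative ip T : Prop := forall p, T p -> 0 <= ip p.2 p.1.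

Definition orthonormal_basis ip (N E : set H) : Prop :=
  [/\ E `<=` N,
      forall e, E e -> ip e e = 1,
      forall e f, E e -> E f -> e <> f -> ip e f = 0
    & forall x, N x -> (forall e, E e -> ip x e = 0) -> x = 0].

(* The defect numbers of S are the Hilbert dimensions of ker (S^* -/+ i I),
   that is, the cardinalities of their orthonormal bases. *)
Definition equal_defect_numbers ip S : Prop :=
  exists E F : set H,
    [/\ orthonormal_basis ip (ker_sub (adjoint ip S) 'i) E,
        orthonormal_basis ip (ker_sub (adjoint ip S) (- 'i)) F
      & (E #= F)%card].

Definition regular_type S (r : R) : Prop :=
  exists2 k : R[i], 0 < k &
    forall p, S p -> k * `|p.1| <= `|p.2 - r%:C *: p.1|.

Definition restriction T (D : set H) : set (H * H) := [set p | T p /\ D p.1].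

Definition sum_set (D E : set H) : set H := [set x + y | x in D & y in E].

Definition transversal_ext ip S A B : Prop :=
  dom A `&` dom B = dom S /\ sum_set (dom A) (dom B) = dom (adjoint ip S).

Definition fundamental_symmetry ip J : Prop :=
  [/\ bounded_op J, forall x y, ip (J x) y = ip x (J y)
    & forall x, J (J x) = x].

Definition nontrivial J : Prop :=
  ~ (forall x, J x = x) /\ ~ (forall x, J x = - x).

Definition C_symmetry ip J S C : Prop :=
  [/\ bounded_op C,
      forall x, C (C x) = x,
      forall x y, ip (J (C x)) y = ip x (J (C y)),
      forall x, x != 0 -> 0 < ip (J (C x)) x
    & commute_with S C].

Definition ip_C ip J C : H -> H -> R[i] := fun x y => ip (J (C x)) y.

Definition J_selfadjoint ip J A : Prop :=
  [/\ is_operator A, dense (dom A)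
    & comp_right (adjoint ip A) J = comp_left J A].

Definition Sigma_J ip J S : set (set (H * H)) :=
  [set A | J_selfadjoint ip J A /\ S `<=` A].

Definition Upsilon ip J S : set (set (H * H)) :=
  [set A | Sigma_J ip J S A /\ forall C, C_symmetry ip J S C -> commute_with A C].

(* The domain of the closure of the form t[x] = (T x, x), dom t = dom T. *)
Definition closed_form_dom ip T : set H :=
  [set x | exists u v : nat -> H,
     [/\ forall n, T (u n, v n),
         u n @[n --> \oo] --> x
       & forall e : R[i], 0 < e -> exists N : nat, forall m n : nat,
           (N <= m)%N -> (N <= n)%N -> `|ip (v n - v m) (u n - u m)| < e]].

Definition friedrichs ip T : set (H * H) :=
  restriction (adjoint ip T) (closed_form_dom ip T).

(* S_K = ((S^-1)_F)^-1, where the inverses are taken as linear relations;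
   see J. Behrndt, S. Hassi, H. de Snoo, Boundary Value Problems, Weyl
   Functions, and Differential Operators, Section 5.4. *)
Definition krein_von_neumann ip S : set (H * H) :=
  inverse (friedrichs ip (inverse S)).

End Operators.

(* Main.v *)
Require Import Defs.
From mathcomp Require Import all_boot all_order all_algebra.
From mathcomp Require Import complex ring lra.
From mathcomp Require Import all_classical all_reals all_analysis.
Import Order.TTheory GRing.Theory Num.Theory.
Import numFieldNormedType.Exports.

Set Implicit Arguments.
Unset Strict Implicit.
Unset Printing Implicit Defensive.

Local Open Scope classical_set_scope.
Local Open Scope ring_scope.
Local Open Scope complex_scope.

(** Every C-symmetry [C] of [S] also commutes with [S^*], because [J C] is
    self-adjoint and [S] commutes with [J]. So an extension of [S] that is
    constructed from [S] alone, and is self-adjoint, belongs to [Upsilon] as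
    soon as its construction is stable under such a [C]. For (iii) we take
    [A' = S + (S^* minus A)], where [minus] is the orthogonal complement in the
    graph inner product: [S^* minus A] is the set of the [(v, - u)] in [S^*]
    with [(u, v)] in [A], which commutes with [C] when [A] does. For (iv) the
    Friedrichs extension of a nonnegative linear relation [T] is self-adjoint
    because [T_F + 1] is surjective, the preimage of [h] being the limit of a
    sequence minimizing [(y, x) + (x, x) - 2 Re (h, x)] over the [(x, y)] in [T];
    applied to [S^-1] this also gives the Krein-von Neumann extension. The domain
    of the closed form is stable under [C] by Reid's inequality for [J C]. *)

(** * The real part of the inner product *)

(** Real values make quadratic estimates and limits ordinary real arithmetic; complex identities are
    recovered by [adjointP_re]. *)
Definition rdot {R : realType} {H : lmodType R[i]} (ip : H -> H -> R[i])
  (x y : H) : R := complex.Re (ip x y).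

Section RealInnerProduct.
Variables (R : realType) (H : lmodType R[i]) (ip : {dot H for (@Num.conj R[i])}).
Notation rip := (rdot ip).

Lemma ipC x y : ip x y = (ip y x)^*.
Proof. by rewrite hermC expr0 mul1r. Qed.

Lemma rdotC x y : rip x y = rip y x.
Proof. by rewrite /rdot ipC; case: (ip y x). Qed.

Lemma rdotDl x y z : rip (x + y) z = rip x z + rip y z.
Proof. by rewrite /rdot linearDl raddfD. Qed.

Lemma rdotNl x y : rip (- x) y = - rip x y.
Proof. by rewrite /rdot linearNl raddfN. Qed.

Lemma rdotBl x y z : rip (x - y) z = rip x z - rip y z.
Proof. by rewrite rdotDl rdotNl. Qed.

Lemma rdotZl (a : R) x y : rip (a%:C *: x) y = a * rip x y.
Proof.
by rewrite /rdot linearZl_LR /=; case: (ip x y) => u v /=; rewrite mul0r subr0.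
Qed.

Lemma rdotNr x y : rip x (- y) = - rip x y.
Proof. by rewrite rdotC rdotNl rdotC. Qed.

Lemma rdotDr x y z : rip x (y + z) = rip x y + rip x z.
Proof. by rewrite rdotC rdotDl !(rdotC _ x). Qed.

Lemma rdotBr x y z : rip x (y - z) = rip x y - rip x z.
Proof. by rewrite rdotDr rdotNr. Qed.

Lemma rdotZr (a : R) x y : rip x (a%:C *: y) = a * rip x y.
Proof. by rewrite rdotC rdotZl rdotC. Qed.

Lemma rdotZ (a : R[i]) x y : rip (a *: x) (a *: y) =
  (complex.Re a ^+ 2 + complex.Im a ^+ 2) * rip x y.
Proof.
rewrite /rdot linearZl_LR linearZr_LR /=.
by case: a (ip x y) => [a b] [u v] /=; ring.
Qed.

Lemma rdot_ge0 x : 0 <= rip x x.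
Proof. by rewrite /rdot; have := dnorm_ge0 ip x; rewrite lecE => /andP[]. Qed.

Lemma rdot_eq0 x : rip x x = 0 -> x = 0.
Proof.
move=> x0; apply/eqP; rewrite -(dnorm_eq0 ip) eq_complex [_ == _ :> R]/=.
have := dnorm_ge0 ip x; rewrite lecE => /andP[/eqP -> _].
by rewrite /= eqxx andbT; apply/eqP.
Qed.

(* Linearity of a linear relation lets the complex identity defining the
   adjoint be tested on real parts, via multiplication by i. *)
Lemma adjointP_re (T : set (H * H)) p :
  (forall q, T q -> T ('i *: q.1, 'i *: q.2)) ->
  (forall q, T q -> rip q.2 p.1 = rip q.1 p.2) ->
  forall q, T q -> ip q.2 p.1 = ip q.1 p.2.
Proof.
move=> iT rT q Tq; have := rT _ Tq; have /= := rT _ (iT _ Tq).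
rewrite /rdot !linearZl_LR /=.
case: (ip q.2 p.1) (ip q.1 p.2) => [a b] [c d] /=.
by rewrite !mul0r !mul1r !sub0r => /oppr_inj -> ->.
Qed.

End RealInnerProduct.

(** * Cauchy-Schwarz and Riesz representation for semidefinite real forms *)

(** The quadratic [s |-> b (s p + q) (s p + q)] is nonnegative. Symmetry is asked on [M] only,
    because the form of a symmetric relation is symmetric on its graph and not beyond. *)
Lemma psd_CauchySchwarz (R : realType) (V : lmodType R[i]) (M : set V)
    (b : V -> V -> R) :
    (forall (a : R) p q, M p -> M q -> M (a%:C *: p + q)) ->
    (forall (a : R) p q s, b (a%:C *: p + q) s = a * b p s + b q s) ->
    (forall p q, M p -> M q -> b p q = b q p) ->
    (forall p, M p -> 0 <= b p p) ->
  forall p q, M p -> M q -> (b p q) ^+ 2 <= b p p * b q q.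
Proof.
move=> MP bP bC b_ge0 p q Mp Mq.
have quad (s : R) : 0 <= s ^+ 2 * b p p + 2 * s * b p q + b q q.
  have Ms := MP s _ _ Mp Mq; apply: (le_trans (b_ge0 _ Ms)).
  rewrite le_eqVlt; apply/orP; left; apply/eqP.
  by rewrite bP (bC p (_ + _)) // (bC q (_ + _)) // !bP (bC q p) //; ring.
move: (b p p) (b p q) (b q q) (b_ge0 _ Mp) quad => P C Q P0 quad.
have [PE|P_neq0] := eqVneq P 0; last first.
  have {P_neq0}P0 : 0 < P by rewrite lt_def P_neq0.
  (* [- C / P] minimizes the quadratic. *)
  have := quad (- C / P); rewrite -(pmulr_rge0 _ P0).
  have -> : P * ((- C / P) ^+ 2 * P + 2 * (- C / P) * C + Q) = P * Q - C ^+ 2.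
    by field; rewrite gt_eqF.
  by rewrite subr_ge0.
have [->|C_neq0] := eqVneq C 0; first by rewrite expr0n /= PE mul0r.
(* With [P = 0] the quadratic is affine in [s], and this [s] gives it the value [-1]. *)
have := quad (- (Q + 1) / (2 * C)); rewrite PE mulr0 add0r.
have -> : 2 * (- (Q + 1) / (2 * C)) * C + Q = -1 by field.
by rewrite lerNr oppr0 ler10.
Qed.

(* A minimizing sequence of [b p p - 2 * l p] represents [l] in the limit; this
   replaces the Riesz theorem in the completion of [M] for [b]. *)
Lemma approximate_riesz (R : realType) (V : lmodType R[i]) (M : set V)
    (b : V -> V -> R) (l : V -> R) (c : R) :
    M 0 ->
    (forall (a : R) p q, M p -> M q -> M (a%:C *: p + q)) ->
    (forall (a : R) p q s, b (a%:C *: p + q) s = a * b p s + b q s) ->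
    (forall p q, M p -> M q -> b p q = b q p) ->
    (forall p, M p -> 0 <= b p p) ->
    (forall (a : R) p q, l (a%:C *: p + q) = a * l p + l q) ->
    (forall p, M p -> c <= b p p - 2 * l p) ->
  exists u : nat -> V, [/\ forall n, M (u n),
    forall m n, b (u m - u n) (u m - u n) <= 2 * (m.+1%:R^-1 + n.+1%:R^-1)
  & forall n f, M f -> (b (u n) f - l f) ^+ 2 <= (1 + b f f) / n.+1%:R].
Proof.
move=> M0 MP bP bC b_ge0 lP phi_ge.
pose phi p := b p p - 2 * l p; pose E := phi @` M; pose i := inf E.
have Einf : has_inf E.
  by split; [exists (phi 0), 0 | exists c => _ [p Mp <-]; exact: phi_ge].
have i_le p : M p -> i <= phi p.
  by move=> Mp; apply: ge_inf; [case: Einf | exists p].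
have /choice[u uP] : forall n, exists p, M p /\ phi p < i + n.+1%:R^-1.
  move=> n; have [|_ [p Mp <-] lt_p] := @inf_adherent R E n.+1%:R^-1 _ Einf.
    by rewrite invr_gt0 ltr0n.
  by exists p.
have var (s : R) p f : M p -> M f ->
    i <= phi p + s ^+ 2 * b f f + 2 * s * (b p f - l f).
  move=> Mp Mf; have Mq := MP s _ _ Mf Mp.
  rewrite (le_trans (i_le _ Mq))// le_eqVlt; apply/orP; left; apply/eqP.
  rewrite /phi bP lP (bC f) // (bC p (_ + _)) // !bP (bC f p) //.
  by ring.
exists u; split=> [n|m n|n f Mf]; first by case: (uP n).
- have [Mm lt_m] := uP m; have [Mn lt_n] := uP n.
  have Mf : M (u m - u n).
    by rewrite addrC -scaleN1r -[-1](rmorphN1 (real_complex R)); exact: MP.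
  move: (u m - u n) (subrK (u n) (u m)) Mf => f fE Mf.
  (* The value [1/2] reaches the midpoint of [u n] and [u m], where [phi] is still at least [i]: the
     parallelogram argument. *)
  have := var (1/2) _ _ Mn Mf.
  have phim : phi (u m) = phi (u n) + b f f + 2 * (b (u n) f - l f).
    have {1}-> : u m = 1%:C *: f + u n by rewrite rmorph1 scale1r fE.
    have Mfn := MP 1 _ _ Mf Mn.
    rewrite /phi bP lP (bC f) // (bC (u n) (_ + _)) // !bP (bC f (u n)) //.
    by ring.
  move: lt_m lt_n; rewrite phim; set x := m.+1%:R^-1; set y := n.+1%:R^-1.
  by lra.
- have [Mn lt_n] := uP n; have f0 := b_ge0 _ Mf.
  set d := b (u n) f - l f.
  (* This value minimizes [s ^+ 2 * (1 + b f f) + 2 * s * d], with minimum [- d ^+ 2 / (1 + b f f)];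
     the added 1 keeps the denominator positive when [b f f = 0]. *)
  have := var (- d / (1 + b f f)) _ _ Mn Mf; rewrite -/d.
  move: lt_n; set x := n.+1%:R^-1; move: (b f f) f0 => B B0 lt_n.
  have B1 : 0 < 1 + B by lra.
  rewrite -ler_pdivrMl // => i_le_n.
  suff : (1 + B)^-1 * d ^+ 2 = - ((- d / (1 + B)) ^+ 2 * (1 + B)
     + 2 * (- d / (1 + B)) * d).
    move=> ->; have := sqr_ge0 (- d / (1 + B)); move: i_le_n lt_n.
    set s := - d / (1 + B) => i_le_n lt_n s0.
    by rewrite mulrDr mulr1; lra.
  by field; rewrite gt_eqF.
Qed.

(** * Convergence and completeness through the real inner product *)

Section HilbertTopology.
Variables (R : realType) (H : completeNormedModType R[i]).
Variables (ip : {dot H for (@Num.conj R[i])}) (hH : is_hilbert ip).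
Notation rip := (rdot ip).
Implicit Types (u v : nat -> H) (T : set (H * H)).

Lemma norm_rdot x : `|x| = (Num.sqrt (rip x x))%:C.
Proof.
have /complex_realP[r rE] : `|x| \is Num.real by apply: ger0_real.
have r0 : 0 <= r by rewrite -ler0c -rE.
by rewrite /rdot hH rE -rmorphXn /= sqrtr_sqr ger0_norm.
Qed.

Lemma norm_lt_rdot x (e : R) : 0 < e -> (`|x| < e%:C) = (rip x x < e ^+ 2).
Proof.
move=> e0; rewrite norm_rdot ltcR -{1}(gtr0_norm e0) -sqrtr_sqr ltr_sqrt//.
by rewrite exprn_gt0.
Qed.

Lemma complex_gt0P (e : R[i]) : 0 < e -> exists2 r : R, 0 < r & e = r%:C.
Proof.
by case: e => a b; rewrite ltcE /= => /andP[/eqP -> a0]; exists a.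
Qed.

Lemma cvg_rdotP u x :
  u n @[n --> \oo] --> x <-> rip (u n - x) (u n - x) @[n --> \oo] --> (0 : R).
Proof.
split=> [/cvgrPdist_lt ux|/cvgrPdist_lt ux].
  apply/cvgrPdist_lt => e e0; have se0 : 0 < Num.sqrt e by rewrite sqrtr_gt0.
  have := ux (Num.sqrt e)%:C; rewrite ltcR => /(_ se0).
  apply: filterS => n; rewrite distrC norm_lt_rdot// sqr_sqrtr ?ltW// sub0r normrN.
  by rewrite ger0_norm ?rdot_ge0.
apply/cvgrPdist_lt => _ /complex_gt0P[e e0 ->].
have := ux (e ^+ 2) (exprn_gt0 _ e0); apply: filterS => n.
by rewrite sub0r normrN ger0_norm ?rdot_ge0// -norm_lt_rdot// distrC.
Qed.

Lemma cauchy_rdot_cvg u :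
  (forall e : R, 0 < e -> exists N : nat, forall m n,
     (N <= m)%N -> (N <= n)%N -> rip (u n - u m) (u n - u m) < e) ->
  exists x : H, u n @[n --> \oo] --> x.
Proof.
move=> uC; suff : cvg (u @ \oo) by move=> /cvg_ex.
  apply: cauchy_cvg; apply/cauchy_ballP => _ /complex_gt0P[e e0 ->].
have [N NP] := uC _ (exprn_gt0 2 e0).
pose U := [set x | exists2 n, (N <= n)%N & x = u n].
have UF : (u @ \oo) U by exists N => // n Nn; exists n.
exists (U, U) => //= -[_ _] [/= [m Nm ->] [n Nn ->]].
rewrite -ball_normE /= norm_lt_rdot//; exact: NP.
Qed.

Lemma rdot_CauchySchwarz x y : (rip x y) ^+ 2 <= rip x x * rip y y.
Proof.
apply: (psd_CauchySchwarz (M := setT) (b := rip)) => //.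
- by move=> a p q s; rewrite rdotDl rdotZl.
- by move=> p q _ _; exact: rdotC.
- by move=> p _; exact: rdot_ge0.
Qed.

Lemma cvg_rdot u x y : u n @[n --> \oo] --> x ->
  rip (u n) y @[n --> \oo] --> rip x y.
Proof.
move=> /cvg_rdotP/cvgrPdist_lt ux; apply/cvgrPdist_lt => e e0.
have y1 : 0 < rip y y + 1 by rewrite ltr_wpDl ?rdot_ge0.
have := ux (e ^+ 2 / (rip y y + 1)); rewrite divr_gt0 ?exprn_gt0//.
move=> /(_ isT); apply: filterS => n.
rewrite sub0r normrN ger0_norm ?rdot_ge0// ltr_pdivlMr// => lt_e.
rewrite distrC -rdotBl -(ltr_pXn2r (n := 2)) ?nnegrE ?(ltW e0)//.
rewrite real_normK ?num_real//.
apply: le_lt_trans lt_e; apply: le_trans (rdot_CauchySchwarz _ _) _.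
by rewrite ler_wpM2l ?rdot_ge0// lerDl.
Qed.

End HilbertTopology.

(** * Linear relations *)

Lemma rate_small (R : realType) (c e : R) : 0 < e ->
  exists N : nat, forall m n, (N <= m)%N -> (N <= n)%N ->
    c * (m.+1%:R^-1 + n.+1%:R^-1) < e.
Proof.
move=> e0; pose N := Num.bound (2 * `|c| / e); exists N => m n Nm Nn.
have [c0|c_lt0] := lerP 0 c; last first.
  apply: le_lt_trans e0; by rewrite nmulr_rle0.
have bound k : (N <= k)%N -> c * k.+1%:R^-1 < e / 2.
  move=> Nk; rewrite ltr_pdivrMr ?ltr0n// mulrC -ltr_pdivrMr ?divr_gt0//.
  have -> : c / (e / 2) = 2 * `|c| / e by rewrite ger0_norm//; field; rewrite gt_eqF.
  apply: (@lt_le_trans _ _ N%:R); last by rewrite ler_nat (leq_trans Nk).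
  by apply: archi_boundP; rewrite divr_ge0 ?mulr_ge0 ?normr_ge0 ?ltW.
by rewrite mulrDr [e]splitr ltrD ?bound.
Qed.

(** Single-valuedness is left out so that [inverse S] is covered even when [S] has a kernel. *)
Definition linear_relation {R : realType} {H : lmodType R[i]} (T : set (H * H)) :=
  T 0 /\ forall (a : R[i]) p q, T p -> T q -> T (a *: p + q).

Definition seq_closed {R : realType} {H : completeNormedModType R[i]}
    (T : set (H * H)) :=
  forall w x y, (forall n, T (w n)) -> (w n).1 @[n --> \oo] --> x ->
    (w n).2 @[n --> \oo] --> y -> T (x, y).

Section LinearRelations.
Variables (R : realType) (H : completeNormedModType R[i]).
Variables (ip : {dot H for (@Num.conj R[i])}) (hH : is_hilbert ip).
Notation rip := (rdot ip).
Implicit Types (T A B : set (H * H)).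

Lemma operator_linear T : is_operator T -> linear_relation T.
Proof. by case=> T0 TP _; split. Qed.

Lemma linear_relationZ T a p : linear_relation T -> T p -> T (a *: p).
Proof. by move=> [T0 TP] Tp; rewrite -[_ *: _]addr0; exact: TP. Qed.

Lemma linear_relationD T p q : linear_relation T -> T p -> T q -> T (p + q).
Proof. by move=> [T0 TP] Tp Tq; rewrite -[p]scale1r; exact: TP. Qed.

Lemma linear_relationN T p : linear_relation T -> T p -> T (- p).
Proof. by move=> TL Tp; rewrite -scaleN1r; exact: linear_relationZ. Qed.

Lemma linear_relationB T p q : linear_relation T -> T p -> T q -> T (p - q).
Proof.
by move=> TL Tp Tq; apply: linear_relationD => //; exact: linear_relationN.
Qed.

Lemma closed_seq_closed T : closed T -> seq_closed T.
Proof.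
move=> Tcl w x y Tw wx wy.
apply: (closed_cvg (F := \oo) (u_ := fun n => ((w n).1, (w n).2)) T) => //.
  by apply: nearW => n; rewrite -surjective_pairing.
exact: cvg_pair wx wy.
Qed.

Lemma adjoint_linear T : linear_relation (adjoint ip T).
Proof.
split=> [q _|a p q Tp Tq r Tr /=]; first by rewrite !linear0r.
by rewrite !linearPr /= (Tp _ Tr) (Tq _ Tr).
Qed.

Lemma adjointP T p : linear_relation T ->
  (forall q, T q -> rip q.2 p.1 = rip q.1 p.2) -> adjoint ip T p.
Proof.
move=> TL; apply: adjointP_re => -[x y] Txy; exact: (linear_relationZ 'i TL Txy).
Qed.

Lemma adjoint_rdot T p q : adjoint ip T p -> T q -> rip q.2 p.1 = rip q.1 p.2.
Proof. by move=> Tp Tq; rewrite /rdot (Tp _ Tq). Qed.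

Lemma adjoint_seq_closed T : linear_relation T -> seq_closed (adjoint ip T).
Proof.
move=> TL w x y Tw wx wy; apply: adjointP => // q Tq /=.
have := cvg_rdot hH (y := q.2) wx; have := cvg_rdot hH (y := q.1) wy.
under eq_cvg do rewrite rdotC -(adjoint_rdot (Tw _) Tq) rdotC.
by rewrite (rdotC _ q.2) (rdotC _ q.1) => l1 l2; apply: (cvg_unique _ l2 l1).
Qed.

(** This and the next lemma turn the two estimates of [approximate_riesz] into convergence. *)
Lemma rate_cvg (w : nat -> H) (c : R) :
  (forall m n, rip (w m - w n) (w m - w n) <= c * (m.+1%:R^-1 + n.+1%:R^-1)) ->
  exists x : H, w n @[n --> \oo] --> x.
Proof.
move=> wP; apply: (cauchy_rdot_cvg hH) => e /(rate_small c)[N NP].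
by exists N => m n Nm Nn; apply: le_lt_trans (wP n m) _; exact: NP.
Qed.

Lemma rate_cvg0 (f : nat -> R) l (c : R) :
  (forall n, (f n - l) ^+ 2 <= c / n.+1%:R) -> f n @[n --> \oo] --> l.
Proof.
move=> fP; apply/cvgrPdist_lt => e e0.
have [N NP] := rate_small c (exprn_gt0 2 e0).
exists N => // n /= Nn; rewrite distrC -(ltr_pXn2r (n := 2)) ?nnegrE ?(ltW e0)//.
rewrite real_normK ?num_real//; apply: le_lt_trans (fP n) _.
apply: le_lt_trans (NP _ _ Nn Nn); rewrite mulrDr lerDl.
exact: le_trans (sqr_ge0 _) (fP n).
Qed.

(** The real part of the graph inner product; on a complex subspace it has the same orthogonal
    complement as the complex one. *)
Definition gdot (p q : H * H) : R := rip p.1 q.1 + rip p.2 q.2.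

Lemma gdot_eq0 p : gdot p p = 0 -> p = 0.
Proof.
rewrite /gdot; have := rdot_ge0 ip p.1; have := rdot_ge0 ip p.2 => p2 p1 p0.
have /rdot_eq0 p1E : rip p.1 p.1 = 0 by lra.
have /rdot_eq0 p2E : rip p.2 p.2 = 0 by lra.
by rewrite [p]surjective_pairing p1E p2E.
Qed.

(** Representing the functional [gdot p] on [T] minimizes the distance from [p] to [T]; the lower
    bound [- gdot p p] is [gdot (p - q) (p - q) >= 0] expanded. *)
Lemma graph_projection T p : linear_relation T -> seq_closed T ->
  exists2 q, T q & forall r, T r -> gdot (p - q) r = 0.
Proof.
move=> TL Tcl.
have [//|a q r|a q r s|q r _ _|q _|a q r|q _|w [Tw wC wl]] :=
  @approximate_riesz R (H * H)%type T gdot (gdot p) (- gdot p p).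
- by case: TL.
- by move=> Tq Tr; case: TL => _; apply.
- by rewrite /gdot /= !rdotDl !rdotZl; ring.
- by rewrite /gdot !(rdotC ip r.1) !(rdotC ip r.2).
- by rewrite addr_ge0 ?rdot_ge0.
- by rewrite /gdot /= !rdotDr !rdotZr; ring.
- have := rdot_ge0 ip (p.1 - q.1); have := rdot_ge0 ip (p.2 - q.2).
  rewrite /gdot !rdotBl !rdotBr (rdotC ip q.1) (rdotC ip q.2).
  lra.
have [x wx] : exists x : H, (w n).1 @[n --> \oo] --> x.
  apply: (@rate_cvg _ 2) => m n; apply: le_trans (wC m n).
  by rewrite /gdot /= lerDl rdot_ge0.
have [y wy] : exists x : H, (w n).2 @[n --> \oo] --> x.
  apply: (@rate_cvg _ 2) => m n; apply: le_trans (wC m n).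
  by rewrite /gdot /= lerDr rdot_ge0.
exists (x, y); first exact: Tcl wx wy.
move=> r Tr; have /rate_cvg0 l1 := fun n => wl n r Tr.
have l2 : gdot (w n) r @[n --> \oo] --> gdot (x, y) r.
  by apply: cvgD; exact: cvg_rdot.
have : gdot p r = gdot (x, y) r by apply: (cvg_unique _ l1 l2).
by rewrite /gdot /= !rdotBl; lra.
Qed.

End LinearRelations.

(** * Extensions commuting with the C-symmetries *)

Definition invariant {R : realType} {H : lmodType R[i]} (T : set (H * H))
  (C : H -> H) := forall p, T p -> T (C p.1, C p.2).

Section Extensions.
Variables (R : realType) (H : completeNormedModType R[i]).
Variables (ip : {dot H for (@Num.conj R[i])}) (hH : is_hilbert ip).
Notation rip := (rdot ip).
Implicit Types (T A B S : set (H * H)) (C J : {linear H -> H}).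

(** Applying the inclusion once more to [C p] and using [C^2 = I] gives the reverse inclusion. *)
Lemma commute_withP T C : involutive C -> commute_with T C <-> invariant T C.
Proof.
move=> CK; split=> [TC [x y] Txy|TC].
  suff : comp_right T C (x, C y) by [].
  by rewrite TC; exists y.
apply/seteqP; split=> -[x y] /=.
  by move=> /TC /=; rewrite CK => Txy; exists (C y) => //; rewrite CK.
by move=> [z /= Txz ->]; exact: TC Txz.
Qed.

Lemma symmetric_sub_adjoint T : symmetric_op ip T -> T `<=` adjoint ip T.
Proof. by move=> Tsym p Tp q Tq; exact: Tsym. Qed.

Lemma adjointS T A : T `<=` A -> adjoint ip A `<=` adjoint ip T.
Proof. by move=> TA p Ap q /TA; exact: Ap. Qed.

(** A point [y] of [D] closer to [x] than [|x|] would give [|x|^2 + |y|^2 = |x - y|^2 < |x|^2]. *)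
Lemma dense_orthogonal (D : set H) x : dense D ->
  (forall y, D y -> rip y x = 0) -> x = 0.
Proof.
move=> Ddense Dx; apply: (rdot_eq0 (ip := ip)); apply/eqP.
rewrite -[_ == _]negbK; apply/negP => x_neq0.
have x0 : 0 < rip x x by rewrite lt_def x_neq0 rdot_ge0.
have s0 : 0 < Num.sqrt (rip x x) by rewrite sqrtr_gt0.
have [||y [/= xy Dy]] := Ddense (ball x (Num.sqrt (rip x x))%:C).
- by exists x; apply: ballxx; rewrite ltcR.
- by apply: ball_open; rewrite ltcR.
move: xy; rewrite -ball_normE /= (norm_lt_rdot hH)// sqr_sqrtr ?ltW//.
rewrite !rdotBl !rdotBr (rdotC ip x y) (Dx _ Dy).
by have := rdot_ge0 ip y; lra.
Qed.

Lemma adjoint_fun T : dense (dom T) ->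
  forall x y z, adjoint ip T (x, y) -> adjoint ip T (x, z) -> y = z.
Proof.
move=> Td x y z Ty Tz; apply/eqP; rewrite -subr_eq0; apply/eqP.
apply: (dense_orthogonal Td) => u [v Tuv].
rewrite rdotBr -(adjoint_rdot Ty Tuv) -(adjoint_rdot Tz Tuv) /=; ring.
Qed.

Lemma denseS (D E : set H) : D `<=` E -> dense D -> dense E.
Proof.
by move=> DE Dd O O0 Oo; have [x [Ox /DE Ex]] := Dd O O0 Oo; exists x.
Qed.

Lemma domS T A : T `<=` A -> dom T `<=` dom A.
Proof. by move=> TA x [y /TA]; exists y. Qed.

(** [A = A^*] lies in [S^*], which is single-valued because [dom S] is dense. *)
Lemma selfadjoint_extensionP S A : dense (dom S) -> S `<=` A ->
  adjoint ip A = A -> selfadjoint_extension ip S A.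
Proof.
move=> Sd SA AE; split=> //; split=> //; last exact: denseS (domS SA) Sd.
have [A0 AP] := adjoint_linear ip A.
rewrite AE in A0 AP; split=> // x y z.
rewrite -AE => /(adjointS SA) Sy /(adjointS SA) Sz.
exact: adjoint_fun Sd _ _ _ Sy Sz.
Qed.

(* [S^*] minus [A] in the graph inner product is [V A], [V (u, v) = (v, - u)]. *)
Lemma adjoint_gdot T p : linear_relation T ->
  adjoint ip T (- p.2, p.1) <-> forall q, T q -> gdot ip p q = 0.
Proof.
move=> TL; split=> [Tp q Tq|pT].
  have /= := adjoint_rdot Tp Tq; rewrite /gdot rdotNr (rdotC _ p.1) (rdotC _ p.2).
  by lra.
apply: adjointP => // q Tq /=; have := pT _ Tq.
by rewrite /gdot rdotNr (rdotC _ p.1) (rdotC _ p.2); lra.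
Qed.

(** * Criteria for membership in [Upsilon], transversal extensions, points of regular type *)

Section Csymmetries.
Variables (S : set (H * H)) (hS : is_operator S).
Variables (S_dense : dense (dom S)) (S_sym : symmetric_op ip S).
Variables (J : {linear H -> H}) (hJ : fundamental_symmetry ip J).
Hypothesis (SJ : commute_with S J).

Let JK : involutive J. Proof. by case: hJ. Qed.

(** As [J J = I] is positive, [J] is one of the C-symmetries and its inner product is the original
    one. *)
Lemma C_symmetry_J : C_symmetry ip J S J.
Proof.
case: hJ => Jb _ _; split=> // [x y|x x0]; first by rewrite !JK.
by rewrite JK dnorm_gt0.
Qed.

Lemma C_symmetry_invariant C : C_symmetry ip J S C -> invariant S C.
Proof. by case=> _ CK _ _ /commute_withP; apply. Qed.

(** Self-adjointness of [J C] means [C^* = J C J], which preserves [S]; hence [C] preserves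
    [S^*]. *)
Lemma C_symmetry_adjoint_invariant C : C_symmetry ip J S C ->
  invariant (adjoint ip S) C.
Proof.
move=> CC p Sp q Sq.
have iJ := C_symmetry_invariant C_symmetry_J; have iC := C_symmetry_invariant CC.
have := Sp _ (iJ _ (iC _ (iJ _ Sq))) => /=; case: CC => _ CK JCsym _ _.
case: hJ => _ Jsym _.
by rewrite !JCsym !Jsym !JK.
Qed.

(** Since [J] is among the [C], [A] commutes with [J], and [A^* J = A J = J A]. *)
Lemma Upsilon_selfadjoint A : selfadjoint_extension ip S A ->
  (forall C, C_symmetry ip J S C -> invariant A C) -> Upsilon ip J S A.
Proof.
move=> [[Ao Ad AE] SA] Ainv; split.
  split=> //; split=> //; rewrite AE.
  by apply/commute_withP => //; apply: Ainv; exact: C_symmetry_J.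
move=> C CC; apply/commute_withP; first by case: CC.
exact: Ainv.
Qed.

(** The adjoint of [A] for the new inner product is [C (J A^* J) C]; [J]-self-adjointness reduces it
    to [C A C], and commutation to [A]. *)
Lemma selfadjoint_ip_C A C : Upsilon ip J S A -> C_symmetry ip J S C ->
  selfadjoint_extension (ip_C ip J C) S A.
Proof.
move=> [[[Ao Ad AJ] SA] Acomm] CC; split=> //; split=> //.
have [_ CK JCsym _ _] := CC.
have adjE p : adjoint (ip_C ip J C) A p <-> A (C p.1, C p.2).
  transitivity (adjoint ip A (J (C p.1), J (C p.2))).
    by split=> Ap q Aq; have := Ap _ Aq; rewrite /ip_C /= !JCsym.
  transitivity (comp_left J A (C p.1, J (C p.2))).
    by rewrite -AJ.
  split; last by exists (C p.2).
  by move=> [y /= Ay /(can_inj JK) ->].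
have Ainv : invariant A C by apply/commute_withP => //; exact: Acomm.
apply/seteqP; split=> p; last by move=> /Ainv /adjE.
by move=> /adjE /Ainv /=; rewrite !CK -surjective_pairing.
Qed.

Lemma Upsilon_invariant A C : Upsilon ip J S A -> C_symmetry ip J S C ->
  invariant A C.
Proof.
by move=> [_ Acomm] CC; apply/commute_withP; [case: CC|exact: Acomm].
Qed.

Lemma Upsilon_adjoint A : Upsilon ip J S A -> adjoint ip A = A.
Proof.
move=> AU; have [[_ _ AE] _] := selfadjoint_ip_C AU C_symmetry_J.
rewrite -[RHS]AE; apply/seteqP.
by split=> p Ap q /Ap; rewrite /ip_C !JK.
Qed.

Lemma transversal_Upsilon A : seq_closed S -> Upsilon ip J S A ->
  exists A', [/\ selfadjoint_extension ip S A', transversal_ext ip S A A'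
               & Upsilon ip J S A'].
Proof.
move=> Scl AU; have AE := Upsilon_adjoint AU.
have SL := operator_linear hS.
have [[[Ao _ _] SA] _] := AU; have AL := operator_linear Ao.
have A_S : A `<=` adjoint ip S by rewrite -AE; exact: adjointS.
pose B := adjoint ip S `&` [set b | A (- b.2, b.1)].
(* [A = A^*] identifies the two descriptions of [B]: orthogonality yields the decomposition of
   [S^*], membership in [A] the invariance under [C]. *)
have Bperp b : B b <-> adjoint ip S b /\ forall q, A q -> gdot ip b q = 0.
  by rewrite -(adjoint_gdot b AL) AE.
pose A' := [set s + b | s in S & b in B].
have S_S := symmetric_sub_adjoint S_sym.
have SsL := adjoint_linear ip S.
have BL : linear_relation B.
  split; first by split; [case: SsL | rewrite /= oppr0; case: AL].
  move=> a p q [Sp Ap] [Sq Aq]; split; first by case: SsL => _; apply.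
  by rewrite /= opprD -scalerN; exact: AL.2 a _ _ Ap Aq.
have S_A' : S `<=` A'.
  by move=> s Ss; exists s => //; exists 0; [case: BL | rewrite addr0].
have A'_S : A' `<=` adjoint ip S.
  move=> _ [s Ss [b [Sb _] <-]]; exact: (linear_relationD SsL (S_S _ Ss) Sb).
have A'L : linear_relation A'.
  split; first by apply: S_A'; case: SL.
  move=> a _ _ [s Ss [b Bb <-]] [t St [c Bc <-]].
  exists (a *: s + t); first by case: SL => _; apply.
  exists (a *: b + c); first by case: BL => _; apply.
  by rewrite scalerDr addrACA.
have decomp p : adjoint ip S p -> exists a b, [/\ A a, B b & p = a + b].
  move=> Sp; have [|a Aa pa] := graph_projection hH p AL.
    by rewrite -AE; exact: adjoint_seq_closed.
  exists a, (p - a); split=> //; last by rewrite addrC subrK.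
  by apply/Bperp; split=> //; exact: (linear_relationB SsL Sp (A_S _ Aa)).
have A'_sym p q : A' p -> A' q -> rip q.2 p.1 = rip q.1 p.2.
  move=> [s Ss [b [Sb Ab] <-]] [t St [c [Sc Ac] <-]] /=.
  rewrite !rdotDl !rdotDr.
  have := adjoint_rdot (S_S _ Ss) St; have := adjoint_rdot Sb St.
  have := adjoint_rdot Sc Ss; rewrite (rdotC ip s.2) (rdotC ip s.1).
  (* The pairing of [b] with [c] is settled by symmetry of [A] on [(- b.2, b.1)] and [(- c.2, c.1)];
     the other pairings involve [S] against [S^*]. *)
  have : adjoint ip A (- b.2, b.1) by rewrite AE.
  move=> /adjoint_rdot/(_ Ac) /=; rewrite rdotNl rdotNr.
  by lra.
have A'E : adjoint ip A' = A'.
  apply/seteqP; split=> p; last first.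
    by move=> A'p; apply: adjointP => // q A'q; exact: A'_sym.
  move=> A'p; have Sp := adjointS S_A' A'p.
  have [a [b [Aa Bb pE]]] := decomp _ Sp.
  (* Let [c] be the part of [a] orthogonal to [S]. Then [(c.2, - c.1)] is in [B], and testing [p]
     against it leaves [gdot c c = 0], so that [a] is in [S]. *)
  have [s Ss sP] := graph_projection hH a SL Scl.
  have [c cE] : exists c, c = a - s by exists (a - s).
  rewrite -cE in sP.
  have Ac : A c by rewrite cE; exact: (linear_relationB AL _ (SA _ Ss)).
  have Bc : B (c.2, - c.1).
    split; last by rewrite /= opprK -surjective_pairing.
    have [_ /(_ sP) Sc] := adjoint_gdot c SL.
    by rewrite -[c.2]opprK; exact: linear_relationN SsL Sc.
  have A'c : A' (c.2, - c.1).
    by exists 0; [case: SL | exists (c.2, - c.1); rewrite ?add0r].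
  have c0 : gdot ip c c = 0.
    have := adjoint_rdot A'p A'c; have := sP _ Ss.
    have [_ /(_ _ Ac)] := (Bperp b).1 Bb.
    have -> : p = s + c + b by rewrite pE cE (addrC s) subrK.
    rewrite /gdot /= !rdotDr !rdotNl (rdotC ip b.1) (rdotC ip b.2).
    by lra.
  exists s => //; exists b => //; rewrite pE; congr (_ + _).
  apply/esym/eqP; rewrite -subr_eq0; apply/eqP; rewrite -cE.
  exact: gdot_eq0 c0.
exists A'; split; first exact: selfadjoint_extensionP.
  split; apply/seteqP; split=> x.
  - move=> [[y Ay] [z]] [s Ss [b Bb sbE]].
    have [Sb bA] := (Bperp b).1 Bb.
    (* Both operators restrict [S^*], so they agree at [x]; then [b] lies in [A] and is orthogonal
       to [A]. *)
    have yz : y = z.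
      apply: (adjoint_fun S_dense) (A_S _ Ay) (A'_S _ _).
      by exists s => //; exists b.
    have Ab : A b.
      have -> : b = (x, y) - s by rewrite yz -sbE addrC addKr.
      by exact: (linear_relationB AL _ (SA _ Ss)).
    exists y; suff -> : (x, y) = s by [].
    rewrite yz -sbE -[RHS]addr0; congr (_ + _).
    exact: gdot_eq0 (bA _ Ab).
  - by move=> Sx; split; [exact: domS SA _ Sx | exact: domS S_A' _ Sx].
  - move=> [y [z Ayz] [y' [z' Ayz'] <-]]; exists (z + z').
    exact: (linear_relationD SsL (A_S _ Ayz) (A'_S _ Ayz')).
  - move=> [y /decomp[a [b [Aa Bb [-> yE]]]]].
    exists a.1; first by exists a.2; rewrite -surjective_pairing.
    exists b.1 => //; exists b.2; rewrite -surjective_pairing.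
    by exists 0; [case: SL | exists b; rewrite ?add0r].
apply: Upsilon_selfadjoint; first exact: selfadjoint_extensionP.
move=> C CC _ [s Ss [b [Sb Ab] <-]].
have iS := C_symmetry_invariant CC; have iA := Upsilon_invariant AU CC.
exists (C s.1, C s.2); first exact: iS.
exists (C b.1, C b.2); last by rewrite /= !linearD.
split; first exact: C_symmetry_adjoint_invariant.
by rewrite /= -linearN; exact: iA Ab.
Qed.

(** Regular type makes the range of [S - r] closed, so its orthogonal complement is the kernel [N]
    of [S^* - r]. If [p] is in the adjoint of [A_r], then [h = p.2 - r p.1] is orthogonal to [N],
    hence [h = (S - r) x] for some [x], and [p.1 - x] lies in [N]. *)
Lemma regular_type_Upsilon (r : R) : seq_closed S -> regular_type S r ->
  dom S `&` ker_sub (adjoint ip S) r%:C = [set 0] /\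
  Upsilon ip J S
    (restriction (adjoint ip S)
       (sum_set (dom S) (ker_sub (adjoint ip S) r%:C))).
Proof.
move=> Scl [k /complex_gt0P[{}k k0 ->] kS].
have SL := operator_linear hS; have SsL := adjoint_linear ip S.
have S_S := symmetric_sub_adjoint S_sym.
have kSr p : S p ->
    k ^+ 2 * rip p.1 p.1 <= rip (p.2 - r%:C *: p.1) (p.2 - r%:C *: p.1).
  move=> /kS; rewrite !(norm_rdot hH) -rmorphM lecR => /(lerXn2r 2).
  rewrite !nnegrE exprMn !sqr_sqrtr ?rdot_ge0//; apply.
    by rewrite mulr_ge0 ?sqrtr_ge0 ?ltW.
  by rewrite sqrtr_ge0.
set N := ker_sub _ _; set Ar := restriction _ _.
have SN0 : dom S `&` N = [set 0].
  apply/seteqP; split=> x; last first.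
    move=> ->; split; first by exists 0; case: SL.
    by rewrite /N /ker_sub /= scaler0; case: SsL.
  move=> [[y Sxy] Nx]; have yE := adjoint_fun S_dense (S_S _ Sxy) Nx.
  have := kSr _ Sxy; rewrite /= yE subrr.
  have -> : rip 0 0 = 0 by rewrite /rdot linear0l.
  rewrite pmulr_rle0 ?exprn_gt0// => x0.
  by apply: (rdot_eq0 (ip := ip)); apply/eqP; rewrite eq_le x0 rdot_ge0.
split=> //.
have ArP p : Ar p <-> exists2 s, S s & exists2 n, N n & p = s + (n, r%:C *: n).
  split=> [[Sp [s [s' Ss] [n Nn snE]]]|[s Ss [n Nn ->]]]; last first.
    split; first by apply: (linear_relationD SsL (S_S _ Ss) Nn).
    by exists s.1; [exists s.2; rewrite -surjective_pairing | exists n].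
  exists (s, s') => //; exists n => //.
  case: p snE Sp => x y /= <- Sp; congr (_, _).
  apply: (adjoint_fun S_dense Sp).
  exact: (linear_relationD SsL (S_S _ Ss) Nn).
have S_Ar : S `<=` Ar.
  move=> s Ss; apply/ArP; exists s => //; exists 0.
    by rewrite /N /ker_sub /= scaler0; case: SsL.
  by rewrite scaler0 addr0.
have ArL : linear_relation Ar.
  split; first by apply: S_Ar; case: SL.
  move=> a _ _ /ArP[s Ss [n Nn ->]] /ArP[t St [m Nm ->]].
  apply/ArP; exists (a *: s + t); first by case: SL => _; apply.
  exists (a *: n + m).
    rewrite /N /ker_sub /= scalerDr scalerA mulrC -scalerA.
    exact: (SsL.2 a _ _ Nn Nm).
  rewrite scalerDr addrACA; congr (_ + _); congr (_, _) => /=.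
  by rewrite scalerDr !scalerA mulrC.
have Ar_sym p q : Ar p -> Ar q -> rip q.2 p.1 = rip q.1 p.2.
  move=> /ArP[s Ss [n Nn ->]] /ArP[t St [m Nm ->]] /=.
  rewrite !rdotDl !rdotDr.
  have := adjoint_rdot (S_S _ Ss) St; have := adjoint_rdot Nn St.
  have := adjoint_rdot Nm Ss.
  rewrite /= (rdotC ip s.2) (rdotC ip s.1) !rdotZl !rdotZr.
  by lra.
have ArE : adjoint ip Ar = Ar.
  apply/seteqP; split=> p; last first.
    by move=> Ap; apply: adjointP => // q Aq; exact: Ar_sym.
  move=> Ap; have Sp := adjointS S_Ar Ap.
  pose d (p : H * H) := p.2 - r%:C *: p.1; pose h := d p.
  have dP (a : R) u v : d (a%:C *: u + v) = a%:C *: d u + d v.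
    by rewrite /d /= !scalerDr scalerN !scalerA mulrC opprD addrACA.
  have dB u v : d (u - v) = d u - d v.
    by rewrite /d /= scalerBr !opprB addrACA [RHS]addrACA [- v.2 - _]addrC.
  (* Minimizing [|d u - h|] over [S] projects [h] onto the range of [S - r]. *)
  have [|a u v|a u v w|u v _ _|u _|a u v|u _|w [Sw wC wl]] :=
    @approximate_riesz R (H * H)%type S (fun u v => rip (d u) (d v))
      (fun u => rip h (d u)) (- rip h h).
  - by case: SL.
  - by move=> Su Sv; case: SL => _; apply.
  - by rewrite dP rdotDl rdotZl.
  - by rewrite rdotC.
  - exact: rdot_ge0.
  - by rewrite dP rdotDr rdotZr.
  - move: (d u) h => /= v h; have := rdot_ge0 ip (h - v).
    rewrite rdotBl !rdotBr (rdotC ip v).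
    by lra.
  (* The regular type bound carries the Cauchy estimate from [d (w n)] to [(w n).1]. *)
  have [x wx] : exists x : H, (w n).1 @[n --> \oo] --> x.
    apply: (rate_cvg hH (c := 2 / k ^+ 2)) => m n.
    rewrite mulrAC ler_pdivlMr ?exprn_gt0// mulrC; apply: le_trans (wC m n).
    exact: kSr (linear_relationB SL (Sw m) (Sw n)).
  have [z wz] : exists z : H, d (w n) @[n --> \oo] --> z.
    by apply: (rate_cvg hH (c := 2)) => m n; rewrite -dB.
  have wy : (w n).2 @[n --> \oo] --> z + r%:C *: x.
    have : d (w n) + r%:C *: (w n).1 @[n --> \oo] --> z + r%:C *: x.
      by apply: cvgD wz _; exact: cvgZr.
    by under eq_cvg do rewrite /d subrK.
  have Sxy := Scl _ _ _ Sw wx wy.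
  pose e := h - z.
  have Ne : N e.
    apply: adjointP => // q Sq /=; rewrite rdotZr -rdotZl.
    have /rate_cvg0 l1 := fun n => wl n q Sq.
    have l2 : rip (d (w n)) (d q) @[n --> \oo] --> rip z (d q) by exact: cvg_rdot.
    have : rip h (d q) = rip z (d q) by apply: (cvg_unique _ l1 l2).
    move=> hz; suff : rip (d q) e = 0.
      by rewrite /d rdotBl => /eqP; rewrite subr_eq0 => /eqP.
    by rewrite rdotC /e rdotBl hz subrr.
  (* Both [h] and [z] are orthogonal to [N], which contains [e = h - z]. *)
  have e0 : rip e e = 0.
    have hN n : N n -> rip h n = 0.
      move=> Nn; have An : Ar (n, r%:C *: n).
        by apply/ArP; exists 0; [case: SL|exists n; rewrite ?add0r].
      have := adjoint_rdot Ap An => /=.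
      by rewrite /h /d rdotBl !rdotZl (rdotC _ p.2) (rdotC _ p.1); lra.
    have zN n : N n -> rip z n = 0.
      move=> Nn; have := adjoint_rdot Nn Sxy => /=.
      by rewrite rdotDl rdotZl rdotZr; lra.
    by rewrite {1}/e rdotBl hN // zN // subr0.
  have {}e0 : h = z by apply/eqP; rewrite -subr_eq0; apply/eqP; exact: rdot_eq0 e0.
  apply/ArP; exists (x, z + r%:C *: x) => //; exists (p.1 - x).
    rewrite /N /ker_sub /=.
    have := linear_relationB SsL Sp (S_S _ Sxy).
    congr (adjoint _ _ _); congr (_, _); rewrite -e0 /h /d /=.
    by rewrite scalerBr opprD opprB addrA [p.2 + _]addrC subrK.
  rewrite [LHS]surjective_pairing; congr (_, _) => /=; first by rewrite addrC subrK.
  by rewrite -e0 /h /d scalerBr -addrA [_ *: x + _]addrC subrK subrK.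
apply: Upsilon_selfadjoint; first exact: selfadjoint_extensionP.
move=> C CC p /ArP[s Ss [n Nn ->]]; apply/ArP.
exists (C s.1, C s.2); first exact: C_symmetry_invariant.
exists (C n); last by rewrite /= !linearD linearZ.
have := C_symmetry_adjoint_invariant CC Nn.
by rewrite /N /ker_sub /= linearZ.
Qed.

End Csymmetries.
End Extensions.

(** * The Friedrichs extension of a nonnegative linear relation *)

(** If [b < a], then [c (b / a)^(2^n)] tends to 0 while staying at least 1. *)
Lemma ler_of_pow2 (R : realType) (a b c : R) : 0 <= b -> 0 <= c ->
  (forall n, a ^+ (2 ^ n) <= c * b ^+ (2 ^ n)) -> a <= b.
Proof.
move=> b0 c0 abP; rewrite leNgt; apply/negP => lt_ba.
have a0 : 0 < a by apply: le_lt_trans lt_ba.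
have z0 : 0 <= b / a by rewrite divr_ge0// ltW.
have z1 : b / a < 1 by rewrite ltr_pdivrMr ?mul1r.
have /(cvg_geometric c)/cvgrPdist_lt/(_ 1 ltr01) : `|b / a| < 1.
  by rewrite ger0_norm.
move=> [n _ /(_ n (leqnn n))].
rewrite /= sub0r normrN ger0_norm ?mulr_ge0 ?exprn_ge0// ltNge => /negP; apply.
apply: (@le_trans _ _ (c * (b / a) ^+ (2 ^ n))).
  by rewrite expr_div_n mulrA ler_pdivlMr ?exprn_gt0// mul1r.
by rewrite ler_wpM2l// ler_wiXn2l ?(ltW z1)// ltnW// ltn_expl.
Qed.

Section Friedrichs.
Variables (R : realType) (H : completeNormedModType R[i]).
Variables (ip : {dot H for (@Num.conj R[i])}) (hH : is_hilbert ip).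
Notation rip := (rdot ip).
Variables (T : set (H * H)) (TL : linear_relation T).
Variables (T_sym : symmetric_op ip T) (T_ge0 : nonnegative ip T).

(** The form [(T x, y)], taken on pairs of the graph because [T] may be multivalued. *)
Let form (p q : H * H) := rip p.2 q.1.

Let formP (a : R) p q s : form (a%:C *: p + q) s = a * form p s + form q s.
Proof. by rewrite /form /= rdotDl rdotZl. Qed.

Let formC p q : T p -> T q -> form p q = form q p.
Proof. by move=> Tp Tq; rewrite /form (rdotC ip q.2) /rdot T_sym. Qed.

Let form_ge0 p : T p -> 0 <= form p p.
Proof. by move=> /T_ge0; rewrite lecE /form /rdot /= => /andP[]. Qed.

Let form_CS p q : T p -> T q -> (form p q) ^+ 2 <= form p p * form q q.
Proof.
apply: psd_CauchySchwarz => // a r s; exact: TL.2.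
Qed.

Let ip_form p : T p -> ip p.2 p.1 = (form p p)%:C.
Proof.
by move=> Tp; rewrite /form /rdot RRe_real//; apply: ger0_real; exact: T_ge0.
Qed.

(* Reid's inequality: iterate the Cauchy-Schwarz inequality
   [form (G^n p) (G^n p) ^+ 2 <= form (G^2n p) (G^2n p) * form p p]. *)
Lemma form_bounded (G : {linear H -> H}) (k : R) : 0 <= k ->
    (forall x y, ip (G x) y = ip x (G y)) ->
    (forall x, rip (G x) (G x) <= k * rip x x) -> invariant T G ->
  forall p, T p -> rip (G p.2) (G p.1) <= k * rip p.2 p.1.
Proof.
move=> k0 Gsym Gk TG p Tp.
pose Gn n : H * H := (iter n G p.1, iter n G p.2).
have TGn n : T (Gn n).
  by elim: n => [|n IHn]; [rewrite /Gn -surjective_pairing | exact: TG IHn].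
pose s n := form (Gn n) (Gn n).
have s_ge0 n : 0 <= s n by exact: form_ge0.
have rG x y : rip (G x) y = rip x (G y) by rewrite /rdot Gsym.
have sE n : s n = form (Gn (n + n)%N) p.
  suff iterE m j : rip (iter j G p.2) (iter m G p.1) = rip (iter (m + j) G p.2) p.1.
    exact: iterE.
  by elim: m j => [//|m IHm] j; rewrite addSnnS -IHm /= rG.
have s_sq n : s n ^+ 2 <= s (n + n)%N * s 0.
  by rewrite {1}sE; apply: le_trans (form_CS _ _) _.
(* A crude bound by norms suffices: its constant factor disappears under roots of order [2^n]. *)
have bound n : s n <= k ^+ n * (rip p.1 p.1 + rip p.2 p.2).
  have Gnk x : rip (iter n G x) (iter n G x) <= k ^+ n * rip x x.
    elim: n {s_sq sE s_ge0 s} => [|n IHn] /=; first by rewrite expr0 mul1r.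
    by apply: le_trans (Gk _) _; rewrite exprS -mulrA ler_wpM2l.
  have := rdot_ge0 ip (iter n G p.1 - iter n G p.2).
  rewrite rdotBl !rdotBr mulrDr (rdotC ip (iter n G p.1) (iter n G p.2)).
  have := Gnk p.1; have := Gnk p.2; have := s_ge0 n; rewrite /s /form /=; lra.
suff : s 1 <= k * s 0 by [].
have [s00|s0_neq0] := eqVneq (s 0%N) 0.
  have := s_sq 1; rewrite s00 !mulr0 => s1.
  by rewrite (_ : s 1 = 0)//; apply/eqP; rewrite -sqrf_eq0 eq_le s1 sqr_ge0.
have s0 : 0 < s 0 by rewrite lt_def s0_neq0 s_ge0.
pose c := (rip p.1 p.1 + rip p.2 p.2) / s 0.
(* This is [(s 1 / s 0)^(2^n) <= s (2^n) / s 0] cleared of denominators. *)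
have pow n : s 1 ^+ (2 ^ n) * s 0 <= s (2 ^ n)%N * s 0 ^+ (2 ^ n).
  elim: n => [|n IHn]; first by rewrite expn0 !expr1.
  rewrite -(ler_pM2r s0) expnSr mulnC mul2n -addnn !exprD.
  have -> : s 1 ^+ (2 ^ n) * s 1 ^+ (2 ^ n) * s 0 * s 0 =
      (s 1 ^+ (2 ^ n) * s 0) ^+ 2.
    by rewrite expr2 !mulrA; ring.
  apply: (@le_trans _ _ ((s (2 ^ n)%N * s 0 ^+ (2 ^ n)) ^+ 2)).
    by rewrite lerXn2r ?nnegrE ?mulr_ge0 ?exprn_ge0.
  rewrite exprMn [X in _ * X]expr2 [leRHS](_ : _ =
    (s (2 ^ n + 2 ^ n)%N * s 0) * (s 0 ^+ (2 ^ n) * s 0 ^+ (2 ^ n))); last by ring.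
  by rewrite ler_wpM2r ?s_sq// mulr_ge0 ?exprn_ge0.
apply: (@ler_of_pow2 _ _ _ c).
- by rewrite mulr_ge0.
- by rewrite divr_ge0 ?addr_ge0 ?rdot_ge0.
move=> n; rewrite -(ler_pM2r s0); apply: le_trans (pow n) _.
rewrite exprMn /c; have -> :
    (rip p.1 p.1 + rip p.2 p.2) / s 0 * (k ^+ (2 ^ n) * s 0 ^+ (2 ^ n)) * s 0
  = k ^+ (2 ^ n) * (rip p.1 p.1 + rip p.2 p.2) * s 0 ^+ (2 ^ n) by field.
by rewrite ler_wpM2r ?exprn_ge0.
Qed.

Lemma closed_form_domP x : closed_form_dom ip T x <->
  exists w, [/\ forall n, T (w n), (w n).1 @[n --> \oo] --> x
    & forall e : R, 0 < e -> exists N : nat, forall m n,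
        (N <= m)%N -> (N <= n)%N -> form (w n - w m) (w n - w m) < e].
Proof.
have normE (w : nat -> H * H) m n : (forall n, T (w n)) ->
    `|ip ((w n).2 - (w m).2) ((w n).1 - (w m).1)| =
    (form (w n - w m) (w n - w m))%:C.
  move=> Tw; have Twmn := linear_relationB TL (Tw n) (Tw m).
  by rewrite -ip_form// ger0_norm//; exact: T_ge0 Twmn.
split=> [[u [v [Tuv ux uvC]]]|[w [Tw wx wC]]].
  exists (fun n => (u n, v n)); split=> // e e0.
  have [|N NP] := uvC e%:C; first by rewrite ltcR.
  exists N => m n Nm Nn; rewrite -ltcR -(normE (fun n => (u n, v n)))//.
  exact: NP.
exists (fun n => (w n).1), (fun n => (w n).2); split=> //.
  by move=> n; rewrite -surjective_pairing.
move=> _ /complex_gt0P[e e0 ->]; have [N NP] := wC e e0.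
by exists N => m n Nm Nn; rewrite normE// ltcR; exact: NP.
Qed.

(** A map bounded both in norm and in the form preserves convergent form-Cauchy sequences. *)
Lemma closed_form_dom_invariant (G : {additive H -> H}) (k l : R) :
    (forall x, rip (G x) (G x) <= k * rip x x) -> invariant T G ->
    (forall p, T p -> rip (G p.2) (G p.1) <= l * rip p.2 p.1) ->
  forall x, closed_form_dom ip T x -> closed_form_dom ip T (G x).
Proof.
move=> Gk TG Gl x /closed_form_domP[w [Tw wx wC]]; apply/closed_form_domP.
exists (fun n => (G (w n).1, G (w n).2)); split=> [n||e e0].
- exact: TG.
- apply/(cvg_rdotP hH) => /=; move/(cvg_rdotP hH) in wx.
  apply: (squeeze_cvgr (f := cst 0)
    (h := fun n => k * rip ((w n).1 - x) ((w n).1 - x))).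
  + by apply: nearW => n; rewrite rdot_ge0 -raddfB Gk.
  + exact: cvg_cst.
  + by rewrite -[X in _ --> X](mulr0 k); apply: cvgMr.
- have l1 : 0 < `|l| + 1 by rewrite ltr_wpDl.
  have [N NP] := wC _ (divr_gt0 e0 l1); exists N => m n Nm Nn.
  have Twmn := linear_relationB TL (Tw n) (Tw m).
  rewrite /form /= -!raddfB; apply: le_lt_trans (Gl _ Twmn) _.
  have := NP _ _ Nm Nn; rewrite ltr_pdivlMr// mulrC; apply: le_lt_trans.
  rewrite ler_wpM2r ?form_ge0//; apply: le_trans (ler_norm l) _.
  by rewrite lerDl.
Qed.

(** The case of ['i] is what [adjointP_re] asks for. *)
Let friedrichsZ a p : friedrichs ip T p -> friedrichs ip T (a *: p).
Proof.
move=> [Tp dp]; split; first exact: (linear_relationZ a (adjoint_linear ip T) Tp).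
apply: (closed_form_dom_invariant (G := *:%R a)
  (k := complex.Re a ^+ 2 + complex.Im a ^+ 2)
  (l := complex.Re a ^+ 2 + complex.Im a ^+ 2)) => //.
- by move=> x; rewrite rdotZ.
- by move=> q Tq; exact: (linear_relationZ a TL Tq).
- by move=> q Tq; rewrite rdotZ.
Qed.

Lemma sub_friedrichs : T `<=` friedrichs ip T.
Proof.
move=> p Tp; split; first exact: symmetric_sub_adjoint.
apply/closed_form_domP; exists (fun=> p); split=> //; first exact: cvg_cst.
by move=> e e0; exists 0%N => m n _ _; rewrite /form subrr /rdot linear0l.
Qed.

(** For fixed [k], [form (w n) (w' k)] tends to [rip z (w' k).1] by definition of the adjoint.
    Cauchy-Schwarz makes this uniform in large [k], as [w] is form-Cauchy and [w'] form-bounded, so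
    the diagonal may be taken. *)
Let form_cvg x z w x' w' : adjoint ip T (x, z) ->
  (forall n, T (w n)) -> (w n).1 @[n --> \oo] --> x ->
  (forall e : R, 0 < e -> exists N : nat, forall m n,
        (N <= m)%N -> (N <= n)%N -> form (w n - w m) (w n - w m) < e) ->
  (forall n, T (w' n)) -> (w' n).1 @[n --> \oo] --> x' ->
  (forall e : R, 0 < e -> exists N : nat, forall m n,
        (N <= m)%N -> (N <= n)%N -> form (w' n - w' m) (w' n - w' m) < e) ->
  form (w n) (w' n) @[n --> \oo] --> rip z x'.
Proof.
move=> Txz Tw wx wC Tw' wx' wC'.
pose d n k := form (w n) (w' k) - rip z (w' k).1.
have d_cvg k : d n k @[n --> \oo] --> (0 : R).
  have -> : d ^~ k = fun n => rip (w n).1 (w' k).2 - rip x (w' k).2.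
    apply/funext => n; rewrite /d formC// /form rdotC; congr (_ - _).
    by rewrite rdotC -(adjoint_rdot Txz (Tw' k)) rdotC.
  rewrite -[X in _ --> X](subrr (rip x (w' k).2)).
  by apply: cvgB; [exact: cvg_rdot | exact: cvg_cst].
have [N0 N0P] := wC' 1 ltr01.
(* From [form (a + b) (a + b) <= 2 * form a a + 2 * form b b] with [b = w' N0] and
   [form a a < 1]. *)
pose K := 2 + 2 * form (w' N0) (w' N0).
have K0 : 0 < K by have := form_ge0 (Tw' N0); rewrite /K; lra.
have KP k : (N0 <= k)%N -> form (w' k) (w' k) <= K.
  move=> N0k; have := N0P N0 k (leqnn _) N0k.
  have TB := linear_relationB TL (Tw' k) (Tw' N0).
  have := form_ge0 (linear_relationB TL TB (Tw' N0)).
  rewrite /K /form /= !rdotBl !rdotBr; have := formC (Tw' k) (Tw' N0); rewrite /form.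
  by lra.
have dC n m k : (N0 <= k)%N ->
    (d n k - d m k) ^+ 2 <= form (w n - w m) (w n - w m) * K.
  move=> N0k; have TB := linear_relationB TL (Tw n) (Tw m).
  have -> : d n k - d m k = form (w n - w m) (w' k).
    by rewrite /d /form /= rdotBl; ring.
  apply: le_trans (form_CS TB (Tw' k)) _.
  by rewrite ler_wpM2l ?form_ge0 ?KP.
have ddiag : d n n @[n --> \oo] --> (0 : R).
  apply/cvgrPdist_lt => e e0.
  have e2 : 0 < e / 2 by rewrite divr_gt0.
  have [N NP] := wC _ (divr_gt0 (exprn_gt0 2 e2) K0).
  exists (maxn N N0) => // n /=; rewrite geq_max => /andP[Nn N0n].
  have /cvgrPdist_lt/(_ _ e2)[M _ MP] := d_cvg n.
  (* The index [m] depends on [n]: it makes [d m n] small, while [d n n - d m n] is small for all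
     large [m]. *)
  pose m := maxn M N.
  have dm : `|d m n| < e / 2.
    by have := MP m (leq_maxl _ _); rewrite /= sub0r normrN.
  have dnm : `|d n n - d m n| < e / 2.
    rewrite -(ltr_pXn2r (n := 2)) ?nnegrE ?(ltW e2)// real_normK ?num_real//.
    apply: le_lt_trans (dC _ _ _ N0n) _; rewrite -ltr_pdivlMr//.
    by apply: NP => //; exact: leq_maxr.
  rewrite sub0r normrN -(subrK (d m n) (d n n)) [e]splitr.
  by apply: le_lt_trans (ler_normD _ _) _; rewrite ltrD.
have -> : (fun n => form (w n) (w' n)) = (fun n => d n n + rip (w' n).1 z).
  by apply/funext => n; rewrite /d (rdotC ip z) subrK.
rewrite -[rip z x']add0r (rdotC ip z); apply: cvgD => //; exact: cvg_rdot.
Qed.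

(** Both sides are limits of the same diagonal sequence, by [form_cvg] with the roles of the two
    elements exchanged. *)
Lemma friedrichs_symmetric p q : friedrichs ip T p -> friedrichs ip T q ->
  ip q.2 p.1 = ip q.1 p.2.
Proof.
move=> Fp; apply: adjointP_re => [r|r]; first exact: friedrichsZ.
case: p r Fp => [x z] [x' z'] [Tp /closed_form_domP[w [Tw wx wC]]].
move=> [Tq /closed_form_domP[w' [Tw' wx' wC']]] /=.
have l1 := form_cvg Tp Tw wx wC Tw' wx' wC'.
have := form_cvg Tq Tw' wx' wC' Tw wx wC.
under eq_cvg do rewrite formC//.
by rewrite (rdotC _ x' z) => l2; apply: (cvg_unique _ l2 l1).
Qed.

Lemma friedrichs_range h : exists x, friedrichs ip T (x, h - x).
Proof.
have [|a p q|a p q s|p q Tp Tq|p Tp|a p q|p Tp|w [Tw wC wl]] :=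
  @approximate_riesz R (H * H)%type T (fun p q => form p q + rip p.1 q.1)
    (fun p => rip h p.1) (- rip h h).
- by case: TL.
- by move=> Tp Tq; exact: TL.2.
- by rewrite formP /= rdotDl rdotZl; ring.
- by rewrite formC// rdotC.
- by rewrite addr_ge0 ?form_ge0 ?rdot_ge0.
- by rewrite rdotDr rdotZr.
- move: (form_ge0 Tp); have := rdot_ge0 ip (h - p.1).
  by rewrite rdotBl !rdotBr (rdotC ip p.1); lra.
have [x wx] : exists x : H, (w n).1 @[n --> \oo] --> x.
  apply: (rate_cvg hH (c := 2)) => m n; apply: le_trans (wC m n).
  by rewrite lerDr form_ge0//; exact: linear_relationB.
exists x; split; last first.
  (* The form is dominated by the form plus the inner product, so the minimizing sequence is
     form-Cauchy too. *)
  apply/closed_form_domP; exists w; split=> // e /(rate_small 2)[N NP].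
  exists N => m n Nm Nn; apply: le_lt_trans (NP _ _ Nn Nm).
  by apply: le_trans (wC n m); rewrite lerDl rdot_ge0.
apply: adjointP => // q Tq /=.
have /rate_cvg0 l1 := fun n => wl n q Tq.
have l2 : form (w n) q + rip (w n).1 q.1 @[n --> \oo] --> rip x q.2 + rip x q.1.
  under eq_cvg do rewrite formC// /form rdotC.
  by apply: cvgD; exact: cvg_rdot.
have : rip h q.1 = rip x q.2 + rip x q.1 by apply: (cvg_unique _ l1 l2).
by rewrite rdotBr (rdotC _ q.2) !(rdotC _ q.1); lra.
Qed.

Lemma friedrichs_selfadjoint : adjoint ip (friedrichs ip T) = friedrichs ip T.
Proof.
have F_F : friedrichs ip T `<=` adjoint ip (friedrichs ip T).
  by move=> p Fp q Fq; exact: friedrichs_symmetric.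
apply/seteqP; split=> // -[x z] aF.
(* Subtracting the element of [T_F] with the same image under [T_F + 1] leaves [x - x'] in the
   kernel of the adjoint plus 1, which is orthogonal to the range of [T_F + 1], the whole space. *)
have [x' Fx'] := friedrichs_range (x + z).
have aB := linear_relationB (adjoint_linear ip _) aF (F_F _ Fx').
suff xx' : x - x' = 0.
  have -> // : (x, z) = (x', x + z - x').
  have {xx'}-> : x = x' by apply/eqP; rewrite -subr_eq0 xx'.
  by rewrite addrAC subrr add0r.
have [y Fy] := friedrichs_range (x - x').
have := adjoint_rdot aB Fy => /=.
have -> : z - (x + z - x') = - (x - x') by rewrite [x + z]addrC -addrA opprD addNKr.
move=> wE; apply: (rdot_eq0 (ip := ip)); move: wE.
by rewrite rdotNr rdotBl => /(canRL (subrK _)); rewrite addNr.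
Qed.

Lemma friedrichs_invariant (C : {additive H -> H}) k l :
    (forall x, rip (C x) (C x) <= k * rip x x) -> invariant T C ->
    invariant (adjoint ip T) C ->
    (forall p, T p -> rip (C p.2) (C p.1) <= l * rip p.2 p.1) ->
  invariant (friedrichs ip T) C.
Proof.
move=> Ck TC T'C Cl p [Tp dp]; split; first exact: T'C.
exact: closed_form_dom_invariant Ck TC Cl _ dp.
Qed.

End Friedrichs.

(** * Friedrichs and Krein-von Neumann extensions under C-symmetries *)

Section NonnegativeExtensions.
Variables (R : realType) (H : completeNormedModType R[i]).
Variables (ip : {dot H for (@Num.conj R[i])}) (hH : is_hilbert ip).
Notation rip := (rdot ip).
Implicit Types (T : set (H * H)).

Lemma bounded_op_rdot (C : {linear H -> H}) : bounded_op C ->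
  exists2 k : R, 0 <= k & forall x, rip (C x) (C x) <= k * rip x x.
Proof.
move=> [M CM]; exists (complex.Re M ^+ 2); first exact: sqr_ge0.
move=> x; have := CM x; rewrite !(norm_rdot hH).
set a := Num.sqrt _; set b := Num.sqrt _.
(* The bound [M] is complex; the order of [R[i]] compares real parts, so [complex.Re M] serves as
   the real bound. *)
have -> : M * b%:C = (complex.Re M * b) +i* (complex.Im M * b).
  by case: M {CM} => m n /=; simpc.
rewrite lecE /= => /andP[_ ab].
have a2 : rip (C x) (C x) = a ^+ 2 by rewrite sqr_sqrtr ?rdot_ge0.
have b2 : rip x x = b ^+ 2 by rewrite sqr_sqrtr ?rdot_ge0.
rewrite a2 b2 -exprMn lerXn2r ?nnegrE ?sqrtr_ge0//.
exact: le_trans (sqrtr_ge0 _) ab.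
Qed.

Lemma adjoint_inverse T : adjoint ip (inverse T) = inverse (adjoint ip T).
Proof.
apply/seteqP; split=> -[x y] /= Txy [u v] Tuv /=; apply/esym.
  exact: (Txy (v, u)).
exact: (Txy (v, u) Tuv).
Qed.

Lemma inverse_linear T : linear_relation T -> linear_relation (inverse T).
Proof. by move=> [T0 TP]; split=> // a p q Tp Tq; exact: TP Tp Tq. Qed.

Lemma inverse_symmetric T : symmetric_op ip T -> symmetric_op ip (inverse T).
Proof. by move=> Tsym p q Tp Tq; apply/esym; exact: Tsym Tp Tq. Qed.

Lemma inverse_nonnegative T : symmetric_op ip T -> nonnegative ip T ->
  nonnegative ip (inverse T).
Proof. by move=> Tsym T0 p Tp; rewrite -(Tsym _ _ Tp Tp); exact: T0 Tp. Qed.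

Lemma inverse_invariant T (C : H -> H) : invariant T C -> invariant (inverse T) C.
Proof. by move=> TC p /TC. Qed.

(* [J C] is self-adjoint and commutes with [T], so Reid's inequality bounds the
   form of [J C p], which is that of [C p] because [J] is unitary. *)
Lemma friedrichs_C_invariant T (J C : {linear H -> H}) :
    linear_relation T -> symmetric_op ip T -> nonnegative ip T ->
    fundamental_symmetry ip J -> bounded_op C ->
    (forall x y, ip (J (C x)) y = ip x (J (C y))) ->
    invariant T J -> invariant T C -> invariant (adjoint ip T) C ->
  invariant (friedrichs ip T) C.
Proof.
move=> TL Tsym T0 [_ Jsym JK] /bounded_op_rdot[k k0 Ck] JCsym TJ TC T'C.
have rJ x y : rip (J x) (J y) = rip x y by rewrite /rdot Jsym JK.
apply: (friedrichs_invariant hH TL T0 Ck TC T'C (l := k)) => p Tp.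
rewrite -rJ; apply: (form_bounded TL Tsym T0 (G := J \o C)) => //=.
- by move=> x; rewrite rJ.
- by move=> q /TC/TJ.
Qed.

(** Adjoints, symmetry, nonnegativity and invariance pass to the inverse relation, so the Krein-von
    Neumann case is the Friedrichs case of [inverse S]. *)
Lemma friedrichs_Upsilon (S : set (H * H)) (J : {linear H -> H}) :
    is_operator S -> dense (dom S) -> symmetric_op ip S -> nonnegative ip S ->
    fundamental_symmetry ip J -> commute_with S J ->
  Upsilon ip J S (friedrichs ip S) /\ Upsilon ip J S (krein_von_neumann ip S).
Proof.
move=> hS Sd Ssym S0 hJ SJ; have SL := operator_linear hS.
have iJ := C_symmetry_invariant (C_symmetry_J hJ SJ).
split; apply: Upsilon_selfadjoint => //.
- apply: selfadjoint_extensionP => //; first exact: sub_friedrichs.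
  exact: friedrichs_selfadjoint.
- move=> C CC; have [Cb _ JCsym _ _] := CC.
  apply: (friedrichs_C_invariant (J := J)) => //.
    exact: C_symmetry_invariant CC.
  exact: C_symmetry_adjoint_invariant hJ SJ _ CC.
- apply: selfadjoint_extensionP => //.
    move=> [x y] Sxy.
    exact: (sub_friedrichs (inverse_linear SL) (inverse_symmetric Ssym)
      (inverse_nonnegative Ssym S0) (_ : inverse S (y, x))).
  rewrite /krein_von_neumann adjoint_inverse friedrichs_selfadjoint//.
  + exact: inverse_linear.
  + exact: inverse_symmetric.
  + exact: inverse_nonnegative.
- move=> C CC; have [Cb _ JCsym _ _] := CC.
  apply: inverse_invariant; apply: (friedrichs_C_invariant (J := J)) => //.
  + exact: inverse_linear.
  + exact: inverse_symmetric.
  + exact: inverse_nonnegative.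
  + exact: inverse_invariant.
  + by apply: inverse_invariant; exact: C_symmetry_invariant CC.
  + rewrite adjoint_inverse; apply: inverse_invariant.
    exact: C_symmetry_adjoint_invariant hJ SJ _ CC.
Qed.

End NonnegativeExtensions.

Theorem theorem3p9 (R : realType) (H : completeNormedModType R[i])
  (ip : {dot H for (@Num.conj R[i])}) (hH : is_hilbert ip)
  (S : set (H * H)) (hS : is_operator S) (S_closed : closed S)
  (S_dense : dense (dom S)) (S_sym : symmetric_op ip S)
  (S_def : equal_defect_numbers ip S)
  (J : {linear H -> H}) (hJ : fundamental_symmetry ip J)
  (J_nontriv : nontrivial J) (SJ : commute_with S J) :
  [/\ forall A, Upsilon ip J S A ->
        forall C, C_symmetry ip J S C -> selfadjoint_extension (ip_C ip J C) S A,
      forall r : R, regular_type S r ->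
        dom S `&` ker_sub (adjoint ip S) r%:C = [set 0] /\
        Upsilon ip J S
          (restriction (adjoint ip S)
             (sum_set (dom S) (ker_sub (adjoint ip S) r%:C))),
      forall A, Upsilon ip J S A ->
        exists A', [/\ selfadjoint_extension ip S A', transversal_ext ip S A A'
                     & Upsilon ip J S A']
    & nonnegative ip S ->
        Upsilon ip J S (friedrichs ip S) /\
        Upsilon ip J S (krein_von_neumann ip S)].
Proof.
have Scl := closed_seq_closed S_closed.
split.
- by move=> A AU C; exact: selfadjoint_ip_C.
- by move=> r; exact: regular_type_Upsilon.
- by move=> A; exact: transversal_Upsilon.
- by move=> S0; exact: friedrichs_Upsilon.
Qed.
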